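(* Let $Q\in\mathbb{R}^{n\times n}$ be symmetric positive definite with eigenvalues $\lambda_1(Q)\le\dots\le\lambda_n(Q)$, let $q\in\mathbb{R}^n$, and consider the $\ell_2$-regularized quadratic problem $$\text{minimize } \tfrac12 x^\top Qx+q^\top x+\tfrac{\delta}{2}\|z\|_2^2\quad\text{subject to } x-z=0 ,$$ and the ADMM iterations with step-size $\rho$ $$x^{k+1}=(Q+\rho I)^{-1}(\rho z^k-\mu^k-q),\qquad z^{k+1}=\frac{\mu^k+\rho x^{k+1}}{\delta+\rho},\qquad \mu^{k+1}=\mu^k+\rho(x^{k+1}-z^{k+1}).$$ For all values of the step-size $\rho>0$ and regularization parameter $\delta>0$, both $x^k$ and $z^k$ in the ADMM iterations converge to $x^\star=z^\star$, the solution of the optimization problem. Moreover, $z^{k+1}-z^\star$ converges at linear rate $\zeta\in(0,1)$ for all $k\ge 0$. The pair of the optimal constant step-size $\rho^\star$ and convergence factor $\zeta^\star$ are given as $$\rho^\star=\begin{cases}\sqrt{\delta\lambda_1(Q)} & \text{if }\delta<\lambda_1(Q),\\ \sqrt{\delta\lambda_n(Q)} & \text{if }\delta>\lambda_n(Q),\\ \delta&\text{otherwise,}\end{cases}\qquad \zeta^\star=\begin{cases}\left(1+\dfrac{\delta+\lambda_1(Q)}{2\sqrt{\delta\lambda_1(Q)}}\right)^{-1} & \text{if }\delta<\lambda_1(Q),\\ \left(1+\dfrac{\delta+\lambda_n(Q)}{2\sqrt{\delta\lambda_n(Q)}}\right)^{-1} & \text{if }\delta>\lambda_n(Q),\\ 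\dfrac12&\text{otherwise.}\end{cases}$$
   Context: $\|\cdot\|$ is the Euclidean norm, and the iterations start from arbitrary initial values. The convergence factor of a sequence $z^k\to z^\star$ is $\sup_{k:\,z^k\ne z^\star}\|z^{k+1}-z^\star\|/\|z^k-z^\star\|$; linear convergence means that this factor lies in $(0,1)$. The convergence factors here are those guaranteed for all initial values (particular initial values may give faster convergence), and they concern the dual error $e^k=z^k-z^\star$. The $z$- and $\mu$-updates give $\mu^{k+1}=\delta z^{k+1}$; using $\mu^k=\delta z^k$ and inserting the $x$-update into the $z$-update, the $z$-iterates are written as $z^{k+1}=Ez^k-\frac{\rho}{\delta+\rho}(Q+\rho I)^{-1}q$ with $E=\frac{1}{\delta+\rho}\left(\delta I+\rho(\rho-\delta)(Q+\rho I)^{-1}\right)$, so that the error dynamics are $e^{k+1}=Ee^k$. The optimal step-size $\rho^\star$ is the one minimizing the convergence factor, and $\zeta^\star$ is the resulting minimal factor. *)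

(* Defs.v *)
From HB Require Import structures.
From mathcomp Require Export all_boot all_order all_algebra.
From mathcomp Require Export all_classical all_reals all_analysis.
Export numFieldNormedType.Exports.
Import Order.TTheory GRing.Theory Num.Theory.

#[export] Set Implicit Arguments.
#[export] Unset Strict Implicit.
#[export] Unset Printing Implicit Defensive.

Local Open Scope classical_set_scope.
Local Open Scope ring_scope.

(* The norm that the library puts on matrices is the sup norm. *)
Definition enorm (R : realType) (n : nat) (x : 'cV[R]_n) : R :=
  Num.sqrt (\sum_(i < n) x i 0 ^+ 2).

Definition posdefmx (R : realType) (n : nat) (Q : 'M[R]_n) : Prop :=
  Q \is symmetricmx /\
  forall x : 'cV[R]_n, x != 0 -> 0 < (x^T *m Q *m x) 0 0.

(* Eigenvalues are listed with multiplicity, in nondecreasing order. *)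
Definition sorted_eigenvalues (R : realType) (n : nat) (Q : 'M[R]_n)
    (lambda : 'I_n -> R) : Prop :=
  char_poly Q = \prod_(i < n) ('X - (lambda i)%:P) /\
  forall i j : 'I_n, (i <= j)%N -> lambda i <= lambda j.

Section ADMM.
Variables (R : realType) (n : nat).
Variables (Q : 'M[R]_n) (q : 'cV[R]_n) (delta : R).

Definition objective (x z : 'cV[R]_n) : R :=
  2^-1 * (x^T *m Q *m x) 0 0 + (q^T *m x) 0 0 + delta / 2 * enorm z ^+ 2.

Definition is_solution (x z : 'cV[R]_n) : Prop :=
  x - z = 0 /\
  forall x' z' : 'cV[R]_n, x' - z' = 0 -> objective x z <= objective x' z'.

(* The initial values [x 0], [z 0], [mu 0] are unconstrained. *)
Definition admm_iterates (rho : R) (x z mu : nat -> 'cV[R]_n) : Prop :=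
  forall k : nat,
  [/\ x k.+1 = invmx (Q + rho%:M) *m (rho *: z k - mu k - q),
      z k.+1 = (delta + rho)^-1 *: (mu k + rho *: x k.+1) &
      mu k.+1 = mu k + rho *: (x k.+1 - z k.+1)].

(* The supremum is taken in the extended reals, so that it is [+oo] when the
   ratios are unbounded; it is [-oo] when the sequence is constantly [zs]. *)
Definition convergence_factor (z : nat -> 'cV[R]_n) (zs : 'cV[R]_n) : \bar R :=
  ereal_sup [set (enorm (z k.+1 - zs) / enorm (z k - zs))%:E
            | k in [set k | z k != zs]].

(* The factor guaranteed for all initial values.  The sequence is started at
   [z 1], because [mu k = delta *: z k], hence the error recursion, holds for
   [k >= 1] but not for [k = 0] when [z 0] and [mu 0] are unrelated. *)
Definition guaranteed_factor (zs : 'cV[R]_n) (rho : R) : \bar R :=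
  ereal_sup [set convergence_factor (fun k => z k.+1) zs
            | z in [set z | exists x mu, admm_iterates rho x z mu]].

Definition optimal_step (zs : 'cV[R]_n) (rho : R) : Prop :=
  0 < rho /\
  forall rho' : R, 0 < rho' ->
    (guaranteed_factor zs rho <= guaranteed_factor zs rho')%E.

End ADMM.

Definition rho_star (R : realType) (delta lambda1 lambdan : R) : R :=
  if delta < lambda1 then Num.sqrt (delta * lambda1)
  else if delta > lambdan then Num.sqrt (delta * lambdan)
  else delta.

Definition zeta_star (R : realType) (delta lambda1 lambdan : R) : R :=
  if delta < lambda1 then
    (1 + (delta + lambda1) / (2 * Num.sqrt (delta * lambda1)))^-1
  else if delta > lambdan then
    (1 + (delta + lambdan) / (2 * Num.sqrt (delta * lambdan)))^-1
  else 2^-1.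

(* Main.v *)
(* From the first step on [mu k = delta *: z k], so the errors obey
   [e (k+1) = E e k] with [E] symmetric and
   [E (Q + rho) = (delta Q + rho^2) / (delta + rho)].  Hence [E] is positive
   semidefinite, and its eigenvalues are the numbers
   [g l = (delta l + rho^2) / ((delta + rho) (l + rho))] for [l] an eigenvalue
   of [Q].  The guaranteed factor is the largest of them, and [g] is monotone
   in [l], so it is [max (g lambda_1) (g lambda_n)].  For fixed [l], [g] is
   uniquely minimal at [rho = sqrt (delta l)], and [g > 1/2] iff
   [(rho - delta) (rho - l) > 0]; this settles the three cases. *)
Require Import Defs.
From mathcomp Require Import ring lra.
Import Order.TTheory GRing.Theory Num.Theory.
Local Open Scope classical_set_scope.
Local Open Scope ring_scope.

(** * The Euclidean inner product and quadratic forms *)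

Section Dot.
Variables (R : realType) (n : nat).
Implicit Types (u v w : 'cV[R]_n) (M : 'M[R]_n) (a t : R).

Definition dot u v : R := (u^T *m v) 0 0.

Lemma dotE u v : dot u v = \sum_i u i 0 * v i 0.
Proof. by rewrite /dot mxE; apply: eq_bigr => i _; rewrite mxE. Qed.

Lemma dotC u v : dot u v = dot v u.
Proof. by rewrite !dotE; apply: eq_bigr => i _; rewrite mulrC. Qed.

Lemma dotDr u v w : dot u (v + w) = dot u v + dot u w.
Proof. by rewrite /dot mulmxDr mxE. Qed.

Lemma dotZr a u v : dot u (a *: v) = a * dot u v.
Proof. by rewrite /dot -scalemxAr mxE. Qed.

Lemma dotBr u v w : dot u (v - w) = dot u v - dot u w.
Proof. by rewrite dotDr -scaleN1r dotZr mulN1r. Qed.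

Lemma dotDl u v w : dot (v + w) u = dot v u + dot w u.
Proof. by rewrite dotC dotDr !(dotC u). Qed.

Lemma dotZl a u v : dot (a *: v) u = a * dot v u.
Proof. by rewrite dotC dotZr dotC. Qed.

Lemma dotBl u v w : dot (v - w) u = dot v u - dot w u.
Proof. by rewrite dotC dotBr !(dotC u). Qed.

Lemma dotNl u v : dot (- v) u = - dot v u.
Proof. by rewrite -scaleN1r dotZl mulN1r. Qed.

Lemma dot_ge0 u : 0 <= dot u u.
Proof. by rewrite dotE sumr_ge0 // => i _; rewrite -expr2 sqr_ge0. Qed.

Lemma dot_eq0 u : (dot u u == 0) = (u == 0).
Proof.
apply/idP/eqP => [|->]; last by rewrite dotE big1 // => i _; rewrite mxE mul0r.
rewrite dotE psumr_eq0 => [/allP u0|i _]; last by rewrite -expr2 sqr_ge0.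
apply/colP => i; rewrite mxE; apply/eqP.
by have := u0 i (mem_index_enum _); rewrite mulf_eq0 orbb.
Qed.

Lemma dot_gt0 u : u != 0 -> 0 < dot u u.
Proof. by move=> u0; rewrite lt_def dot_eq0 u0 dot_ge0. Qed.

Lemma enorm_sq u : enorm u ^+ 2 = dot u u.
Proof.
rewrite /enorm sqr_sqrtr; first by rewrite dotE; apply: eq_bigr.
by rewrite sumr_ge0 // => i _; rewrite sqr_ge0.
Qed.

Lemma enormE u : enorm u = Num.sqrt (dot u u).
Proof. by rewrite -enorm_sq sqrtr_sqr ger0_norm // sqrtr_ge0. Qed.

Lemma enorm_gt0 u : u != 0 -> 0 < enorm u.
Proof. by move=> u0; rewrite enormE sqrtr_gt0 dot_gt0. Qed.

Lemma enormZ a u : 0 <= a -> enorm (a *: u) = a * enorm u.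
Proof.
move=> a0; rewrite !enormE dotZl dotZr mulrA -expr2 sqrtrM ?sqr_ge0 //.
by rewrite sqrtr_sqr ger0_norm.
Qed.

Lemma entry_le_enorm u i : `|u i 0| <= enorm u.
Proof.
rewrite enormE -sqrtr_sqr ler_wsqrtr // dotE (bigD1 i) //= -expr2 lerDl.
by rewrite sumr_ge0 // => j _; rewrite -expr2 sqr_ge0.
Qed.

(** Convergence of column vectors is in the sup norm; this carries Euclidean decay over to it. *)
Lemma mx_norm_le_enorm u : `|u| <= enorm u.
Proof.
rewrite [leLHS]/Num.Def.normr/= mx_normrE; apply: bigmax_le => [|[i j] _].
  exact: sqrtr_ge0.
by rewrite /= ord1 entry_le_enorm.
Qed.

Lemma dot_mulmxl M u v : M^T = M -> dot (M *m u) v = dot u (M *m v).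
Proof. by move=> sM; rewrite /dot trmx_mul sM mulmxA. Qed.

(** Each entry of [M *m u] is, in absolute value, at most the absolute sum of its row times
    [enorm u]. *)
Lemma dot_mulmx_bounded M :
  exists2 K, 0 < K & forall u, dot (M *m u) (M *m u) <= K * dot u u.
Proof.
pose K := \sum_i (\sum_j `|M i j|) ^+ 2.
have K0 : 0 <= K by rewrite sumr_ge0 // => i _; rewrite sqr_ge0.
(* Adding 1 keeps the constant positive when [M = 0]. *)
exists (K + 1) => [|u]; first by rewrite ltr_wpDl.
apply: (@le_trans _ _ (K * dot u u)); last first.
  by rewrite ler_wpM2r ?dot_ge0 // lerDl.
rewrite [leLHS]dotE mulr_suml ler_sum // => i _.
rewrite -expr2 -enorm_sq -exprMn -real_normK ?num_real //.
rewrite ler_sqr ?nnegrE ?mulr_ge0 ?sumr_ge0 ?sqrtr_ge0 //.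
rewrite mxE mulr_suml (le_trans (ler_norm_sum _ _ _)) // ler_sum // => j _.
by rewrite normrM ler_wpM2l // entry_le_enorm.
Qed.

(* Expand the form of [M] at [t *: u - M *m u]. *)
Lemma psd_dot_sq M t : M^T = M -> 0 < t ->
  (forall u, 0 <= dot u (M *m u) <= t * dot u u) ->
  forall u, dot (M *m u) (M *m u) <= t * dot u (M *m u).
Proof.
move=> sM t0 Mt u; set w := M *m u.
have /andP[h _] := Mt (t *: u - w).
have /andP[_ h'] := Mt w.
rewrite mulmxBr -scalemxAr -/w !(dotBl, dotBr, dotZl, dotZr) in h.
rewrite -(dot_mulmxl u w) // -/w in h.
(* Adding [h] and [h'] gives the goal multiplied by [t]. *)
rewrite -(ler_pM2l t0); nra.
Qed.

Lemma singular_kernel M : M \notin unitmx ->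
  exists2 v : 'cV_n, v != 0 & M *m v = 0.
Proof.
rewrite unitmxE unitfE negbK -det_tr => /det0P[v v0 vM].
exists v^T; first by rewrite trmx_eq0.
by apply: trmx_inj; rewrite trmx_mul trmxK vM trmx0.
Qed.

End Dot.

(* The supremum [m] of the Rayleigh quotient is an eigenvalue: if [m%:M - M]
   were invertible, its form would be bounded below by a multiple of the
   squared norm, and [m] could be decreased. *)
Lemma psd_max_eigenvector (R : realType) n (M : 'M[R]_n.+1) : M^T = M ->
  (forall u, 0 <= dot u (M *m u)) ->
  exists m (v : 'cV_n.+1), [/\ v != 0, M *m v = m *: v &
    forall u, dot u (M *m u) <= m * dot u u].
Proof.
move=> sM M0.
pose S := [set t : R | forall u, dot u (M *m u) <= t * dot u u].
have e0 : 0 < dot (const_mx 1 : 'cV[R]_n.+1) (const_mx 1).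
  apply: dot_gt0; apply/eqP => /colP/(_ 0)/eqP.
  by rewrite !mxE oner_eq0.
have S0 t : S t -> 0 <= t.
  by move=> /(_ (const_mx 1)) /(le_trans (M0 _)); rewrite pmulr_lge0.
have [K K0 MK] := dot_mulmx_bounded M.
(* The squared norm of [u - M *m u] is nonnegative, which bounds twice the form by
   [(1 + K) * dot u u]. *)
have SK : S (1 + K).
  move=> u; have := dot_ge0 (u - M *m u); have := MK u.
  have := dot_ge0 u; have := dot_ge0 (M *m u).
  by rewrite !(dotBl, dotBr) (dotC (M *m u) u); lra.
have hS : has_inf S by split; [exists (1 + K) | exists 0 => t /S0].
pose m := inf S.
have Sm : S m.
  move=> u; have [->|u0] := eqVneq u 0.
    by rewrite mulmx0 /dot trmx0 mul0mx mxE mulr0.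
  rewrite -ler_pdivrMr ?dot_gt0 //; apply: lb_le_inf; first by case: hS.
  by move=> t St; rewrite ler_pdivrMr ?dot_gt0 // St.
have m0 := S0 _ Sm.
pose B := m%:M - M.
have BE u : B *m u = m *: u - M *m u by rewrite mulmxBl mul_scalar_mx.
have sB : B^T = B by rewrite /B linearB /= tr_scalar_mx sM.
have [uB|/singular_kernel[v v0]] := boolP (B \in unitmx); last first.
  by rewrite BE => /subr0_eq Mv; exists m, v; split.
have [L L0 BL] := dot_mulmx_bounded (invmx B).
(* [m + 1] stands in for [m], which may be 0. *)
have Bsq : forall u, dot (B *m u) (B *m u) <= (m + 1) * dot u (B *m u).
  apply: psd_dot_sq => [//||u]; first by rewrite ltr_wpDl.
  rewrite BE dotBr dotZr; have := Sm u; have := M0 u; have := dot_ge0 u.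
  by move=> *; apply/andP; split; lra.
(* Chaining [BL] at [B *m u] with [Bsq] bounds the form of [B] below by [c * dot u u]. *)
pose c := ((m + 1) * L)^-1.
have mL0 : 0 < (m + 1) * L by rewrite mulr_gt0 // ltr_wpDl.
have c0 : 0 < c by rewrite invr_gt0.
suff : S (m - c).
  move=> /(ge_inf hS.2) /=; rewrite -/m.
  by rewrite lerBrDr gerDl leNgt c0.
move=> u; have := BL (B *m u); rewrite mulKmx // => uL.
have : c * dot u u <= dot u (B *m u).
  rewrite mulrC ler_pdivrMr // (le_trans uL) // mulrC [leRHS]mulrA.
  by rewrite ler_pM2r // [leRHS]mulrC.
by rewrite BE dotBr dotZr; lra.
Qed.

(** * Eigenvalues of the error matrix as functions of the step-size *)

Section ErrorEigenvalue.
Variables (R : realType) (delta : R).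
Hypothesis delta_gt0 : 0 < delta.
Implicit Types (a b l rho s : R).

(* The eigenvalue of the error matrix [E] attached to the eigenvalue [l] of
   [Q]. *)
Definition err_eig l rho : R :=
  (delta * l + rho ^+ 2) / ((delta + rho) * (l + rho)).

Lemma err_eig_bounds l rho : 0 < l -> 0 < rho -> 0 < err_eig l rho < 1.
Proof.
move=> l0 r0; rewrite /err_eig; apply/andP; split.
  by rewrite divr_gt0 // ?mulr_gt0 ?addr_gt0 ?exprn_gt0 // mulr_gt0.
rewrite ltr_pdivrMr ?mulr_gt0 ?addr_gt0 //.
by have := mulr_gt0 delta_gt0 r0; have := mulr_gt0 l0 r0; lra.
Qed.

(** The cross-multiplied difference has the sign of [(delta - rho) * (b - l)]: [err_eig] is
    nondecreasing in [l] for [rho <= delta] and nonincreasing for [rho >= delta]. *)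
Lemma err_eig_le l b rho : 0 < l -> 0 < b -> 0 < rho ->
  0 <= (delta - rho) * (b - l) -> err_eig l rho <= err_eig b rho.
Proof.
move=> l0 b0 r0 h; rewrite /err_eig ler_pdivrMr ?mulr_gt0 ?addr_gt0 //.
rewrite mulrAC ler_pdivlMr ?mulr_gt0 ?addr_gt0 // -subr_ge0.
have -> : (delta * b + rho ^+ 2) * ((delta + rho) * (l + rho)) -
    (delta * l + rho ^+ 2) * ((delta + rho) * (b + rho)) =
  (delta + rho) * rho * ((delta - rho) * (b - l)) by ring.
by rewrite mulr_ge0 // mulr_ge0 ?addr_ge0 ?ltW.
Qed.

(** The reciprocal of [err_eig l rho] is [1 + (delta + l) * rho / (delta * l + rho ^+ 2)], so this
    is AM-GM, with equality only at [rho = s]. *)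
Lemma err_eig_min l s rho : 0 < l -> 0 < s -> 0 < rho -> s ^+ 2 = delta * l ->
  rho != s -> err_eig l s < err_eig l rho.
Proof.
move=> l0 s0 r0 sE rs; rewrite /err_eig ltr_pdivrMr ?mulr_gt0 ?addr_gt0 //.
rewrite mulrAC ltr_pdivlMr ?mulr_gt0 ?addr_gt0 // -subr_gt0.
rewrite -sE.
have -> : (s ^+ 2 + rho ^+ 2) * ((delta + s) * (l + s)) -
    (s ^+ 2 + s ^+ 2) * ((delta + rho) * (l + rho)) =
  (delta * l - s ^+ 2) * (rho ^+ 2 - s ^+ 2) + (delta + l) * s * (s - rho) ^+ 2.
  by ring.
have ? : 0 < (s - rho) ^+ 2 by rewrite exprn_even_gt0 //= subr_eq0 eq_sym.
by rewrite -sE subrr mul0r add0r mulr_gt0 // mulr_gt0 ?addr_gt0.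
Qed.

Lemma err_eig_sqrt l s : 0 < l -> 0 < s -> s ^+ 2 = delta * l ->
  err_eig l s = (1 + (delta + l) / (2 * s))^-1.
Proof.
move=> l0 s0 sE; rewrite /err_eig -sE.
have -> : (delta + s) * (l + s) = s * (2 * s + (delta + l)).
  transitivity (delta * l + s ^+ 2 + s * (delta + l)); first by ring.
  by rewrite -sE; ring.
have h : 2 * s + (delta + l) != 0.
  by rewrite lt0r_neq0 // addr_gt0 ?mulr_gt0 ?addr_gt0.
have s'0 := lt0r_neq0 s0.
by field; rewrite s'0 h.
Qed.

Lemma err_eig_delta l : 0 < l -> err_eig l delta = 2^-1.
Proof.
move=> l0; rewrite /err_eig; field.
by rewrite !lt0r_neq0 ?addr_gt0.
Qed.

(** Twice the numerator minus the denominator is [(rho - delta) * (rho - l)]. *)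
Lemma err_eig_gt_half l rho : 0 < l -> 0 < rho ->
  0 < (rho - delta) * (rho - l) -> 2^-1 < err_eig l rho.
Proof.
move=> l0 r0 h; rewrite /err_eig ltr_pdivlMr ?mulr_gt0 ?addr_gt0 //; nra.
Qed.

Definition max_err_eig a b rho := Num.max (err_eig a rho) (err_eig b rho).

Lemma err_eig_le_max a b l rho : 0 < a -> a <= l <= b -> 0 < rho ->
  err_eig l rho <= max_err_eig a b rho.
Proof.
move=> a0 /andP[al lb] r0; have l0 := lt_le_trans a0 al.
have b0 := lt_le_trans l0 lb.
rewrite le_max; have [rd|dr] := leP rho delta; apply/orP; [right|left];
  apply: err_eig_le => //; nra.
Qed.

Lemma sqrt_mul_sq l : 0 < l ->
  0 < Num.sqrt (delta * l) /\ Num.sqrt (delta * l) ^+ 2 = delta * l.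
Proof.
move=> l0; have dl := mulr_gt0 delta_gt0 l0.
by rewrite sqrtr_gt0 sqr_sqrtr // ltW.
Qed.

Lemma rho_star_gt0 a b : 0 < a -> a <= b -> 0 < rho_star delta a b.
Proof.
move=> a0 ab; rewrite /rho_star.
case: ifP => _; first exact: (sqrt_mul_sq a0).1.
by case: ifP => _ //; exact: (sqrt_mul_sq (lt_le_trans a0 ab)).1.
Qed.

(** If [delta < a], then [delta <= sqrt (delta * a)], so [err_eig] is nonincreasing in [l] and the
    end [a] dominates; [b < delta] is symmetric. Otherwise [rho = delta] makes both ends one
    half. *)
Lemma max_err_eig_rho_star a b : 0 < a -> a <= b ->
  max_err_eig a b (rho_star delta a b) = zeta_star delta a b.
Proof.
move=> a0 ab; have b0 := lt_le_trans a0 ab.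
rewrite /max_err_eig /rho_star /zeta_star.
have [s0 sE] := sqrt_mul_sq a0; have [t0 tE] := sqrt_mul_sq b0.
case: ltP => [da|_].
  rewrite -(err_eig_sqrt a0 s0 sE); apply: max_l; apply: err_eig_le => //.
  rewrite mulr_le0 // subr_le0 //.
  rewrite -ler_sqr ?nnegrE ?(ltW s0) ?(ltW delta_gt0) // sE expr2.
  by rewrite ler_pM2l // ltW.
case: ltP => [bd|_]; last by rewrite !err_eig_delta ?maxxx.
rewrite -(err_eig_sqrt b0 t0 tE); apply: max_r; apply: err_eig_le => //.
rewrite mulr_ge0 // subr_ge0 //.
rewrite -ler_sqr ?nnegrE ?(ltW t0) ?(ltW delta_gt0) // tE expr2.
by rewrite ler_pM2l // ltW.
Qed.

Lemma max_err_eig_min a b rho : 0 < a -> a <= b -> 0 < rho ->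
  rho != rho_star delta a b -> zeta_star delta a b < max_err_eig a b rho.
Proof.
move=> a0 ab r0; have b0 := lt_le_trans a0 ab.
rewrite /max_err_eig /rho_star /zeta_star lt_max.
have [s0 sE] := sqrt_mul_sq a0; have [t0 tE] := sqrt_mul_sq b0.
case: ltP => [da|ad] rs.
  by rewrite -(err_eig_sqrt a0 s0 sE) err_eig_min.
move: rs; case: ltP => [bd|db] rs.
  by rewrite -(err_eig_sqrt b0 t0 tE) (err_eig_min b0 t0) ?orbT.
(* Here [a <= delta <= b]: a step below [delta] is also below [b], and one above [delta] is also
   above [a]. *)
move: rs; rewrite neq_lt => /orP[rd|dr]; apply/orP; [right|left];
  apply: err_eig_gt_half => //; nra.
Qed.

End ErrorEigenvalue.

(** * Positivity and spectrum of [Q] *)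

Section ADMM.
Variables (R : realType) (n : nat) (Q : 'M[R]_n.+1) (q : 'cV[R]_n.+1).
Variables (lambda : 'I_n.+1 -> R) (delta : R).
Hypotheses (Q_posdef : posdefmx Q) (Q_eigen : sorted_eigenvalues Q lambda).
Hypothesis delta_gt0 : 0 < delta.
Implicit Types (u v w : 'cV[R]_n.+1) (rho l t : R).

Let lambda1 := lambda ord0.
Let lambdan := lambda ord_max.

Let Q_sym : Q^T = Q.
Proof.
have [+ _] := Q_posdef; rewrite is_hermitianmxE expr0 scale1r => /eqP {2}->.
by rewrite map_mx_id.
Qed.

Let Q_gt0 u : u != 0 -> 0 < dot u (Q *m u).
Proof. by move=> u0; rewrite /dot mulmxA; apply: Q_posdef.2. Qed.

Let Q_ge0 u : 0 <= dot u (Q *m u).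
Proof.
have [->|/Q_gt0/ltW//] := eqVneq u 0.
by rewrite mulmx0 /dot mulmx0 mxE.
Qed.

(** [eigenvalueP] speaks of row vectors; transposing by [Q_sym] gives columns. *)
Lemma lambda_eigenvector i :
  exists2 v : 'cV_n.+1, v != 0 & Q *m v = lambda i *: v.
Proof.
have : eigenvalue Q (lambda i).
  rewrite eigenvalue_root_char Q_eigen.1 rootE horner_prod (bigD1 i) //=.
  by rewrite hornerXsubC subrr mul0r.
case/eigenvalueP => v vQ v0; exists v^T; first by rewrite trmx_eq0.
by apply: trmx_inj; rewrite trmx_mul !trmxK Q_sym vQ linearZ /= trmxK.
Qed.

Lemma eigenvector_lambda v l : v != 0 -> Q *m v = l *: v ->
  exists i, l = lambda i.
Proof.
move=> v0 Qv; have : eigenvalue Q l.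
  apply/eigenvalueP; exists v^T; last by rewrite trmx_eq0.
  by rewrite -{1}Q_sym -trmx_mul Qv linearZ.
rewrite eigenvalue_root_char Q_eigen.1 rootE horner_prod => /prodf_eq0[i _].
by rewrite hornerXsubC subr_eq0 => /eqP ->; exists i.
Qed.

Lemma lambda_gt0 i : 0 < lambda i.
Proof.
have [v v0 Qv] := lambda_eigenvector i; have := Q_gt0 v0.
by rewrite Qv dotZr pmulr_lgt0 // dot_gt0.
Qed.

Lemma lambda_le_ends i : lambda1 <= lambda i <= lambdan.
Proof. by rewrite !Q_eigen.2 //= -ltnS. Qed.

Let lambda1_gt0 : 0 < lambda1. Proof. exact: lambda_gt0. Qed.

Let lambda1_le : lambda1 <= lambdan.
Proof. by have /andP[h /(le_trans h)] := lambda_le_ends ord0. Qed.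

Let shiftE rho u : (Q + rho%:M) *m u = Q *m u + rho *: u.
Proof. by rewrite mulmxDl mul_scalar_mx. Qed.

Lemma posdef_shift_unit rho : 0 < rho -> Q + rho%:M \in unitmx.
Proof.
move=> r0; apply/negPn/negP => /singular_kernel[v v0].
rewrite shiftE => /(congr1 (dot v)).
rewrite dotDr dotZr [RHS]/dot mulmx0 mxE => h.
have := addr_gt0 (Q_gt0 v0) (mulr_gt0 r0 (dot_gt0 v0)).
by rewrite h ltxx.
Qed.

(** * The unique solution of the problem *)

(** On [x = z] the objective is quadratic with Hessian [Q + delta%:M]; this is its critical
    point. *)
Definition minimizer := - (invmx (Q + delta%:M) *m q).

Lemma minimizerP : Q *m minimizer + delta *: minimizer = - q.
Proof. by rewrite -shiftE mulmxN mulKVmx // posdef_shift_unit. Qed.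

(** The expansion has no linear term because [minimizer] is critical; the remainder is positive for
    nonzero [u]. *)
Lemma objective_minimizerD u :
  objective Q q delta (minimizer + u) (minimizer + u) =
  objective Q q delta minimizer minimizer +
  2^-1 * (dot u (Q *m u) + delta * dot u u).
Proof.
have qE v : dot q v = - (dot minimizer (Q *m v) + delta * dot minimizer v).
  by rewrite -(dot_mulmxl _ _ Q_sym) -dotZl -dotDl minimizerP dotNl opprK.
rewrite /objective !enorm_sq -!mulmxA -!/(dot _ _) !qE.
set m := minimizer.
rewrite mulmxDr !(dotDl, dotDr) (dotC u m) -(dot_mulmxl m u Q_sym).
by rewrite (dotC (Q *m m) u); field.
Qed.

Lemma is_solutionP x z :
  is_solution Q q delta x z <-> x = minimizer /\ z = minimizer.
Proof.
split=> [[/subr0_eq <- xmin]|[-> ->]]; last first.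
  split=> [|x' z' /subr0_eq <-]; first by rewrite subrr.
  rewrite -[x'](subrK minimizer) addrC objective_minimizerD lerDl.
  by rewrite mulr_ge0 // addr_ge0 ?Q_ge0 // mulr_ge0 ?dot_ge0 // ltW.
suff -> : x = minimizer by [].
apply/eqP; rewrite -subr_eq0; apply/negPn/negP => u0.
have := xmin minimizer minimizer (subrr _); rewrite leNgt => /negP; apply.
rewrite -[in ltRHS](subrK minimizer x) addrC objective_minimizerD ltrDl.
by rewrite mulr_gt0 // addr_gt0 ?Q_gt0 // mulr_gt0 ?dot_gt0.
Qed.

(** * The error matrix, its spectrum and its norm *)

Definition errmx rho : 'M[R]_n.+1 :=
  (delta + rho)^-1 *: (delta%:M + (rho * (rho - delta)) *: invmx (Q + rho%:M)).

Section FixedStep.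
Variable rho : R.
Hypothesis rho_gt0 : 0 < rho.

Let unitQ := posdef_shift_unit rho_gt0.
Let dr_neq0 : delta + rho != 0.
Proof. by rewrite lt0r_neq0 // addr_gt0. Qed.

Lemma errmx_sym : (errmx rho)^T = errmx rho.
Proof.
rewrite /errmx linearZ /= linearD /= tr_scalar_mx linearZ /= trmx_inv.
by rewrite [(_ + _)^T]linearD /= tr_scalar_mx Q_sym.
Qed.

(** Since [Q + rho%:M] is invertible, every vector has the form used here, in which the inverse
    inside [errmx] cancels. *)
Lemma errmx_shift u : errmx rho *m (Q *m u + rho *: u) =
  (delta + rho)^-1 *: (delta *: (Q *m u) + rho ^+ 2 *: u).
Proof.
rewrite /errmx -scalemxAl mulmxDl mul_scalar_mx -scalemxAl -{2}shiftE mulKmx //.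
congr (_ *: _); rewrite scalerDr -addrA scalerA -scalerDl.
by congr (_ + _ *: _); ring.
Qed.

Lemma errmx_eigenvector v l : 0 < l -> Q *m v = l *: v ->
  errmx rho *m v = err_eig delta l rho *: v.
Proof.
move=> l0 Qv; have lr : l + rho != 0 by rewrite lt0r_neq0 // addr_gt0.
pose f := (l + rho)^-1 *: v.
have Qf : Q *m f = l *: f by rewrite -scalemxAr Qv !scalerA mulrC.
have -> : v = (l + rho) *: f by rewrite scalerA mulfV // scale1r.
rewrite {1}scalerDl -Qf errmx_shift Qf scalerA -scalerDl !scalerA /err_eig.
by congr (_ *: _); field; rewrite lr dr_neq0.
Qed.

(** Conversely to [errmx_eigenvector]: in terms of [f], the eigenvalue equation is a linear relation
    between [Q *m f] and [f]. *)
Lemma errmx_eigenvalue v t : v != 0 -> errmx rho *m v = t *: v ->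
  exists i, t = err_eig delta (lambda i) rho.
Proof.
move=> v0; pose f := invmx (Q + rho%:M) *m v.
have vE : v = Q *m f + rho *: f by rewrite -shiftE mulKVmx.
have f0 : f != 0.
  by apply: contraNneq v0 => f0; rewrite vE f0 mulmx0 scaler0 addr0.
rewrite vE errmx_shift => /(congr1 ( *:%R (delta + rho))).
rewrite [LHS]scalerA mulfV // scale1r scalerA !scalerDr => fE.
pose c := (delta + rho) * t.
have cf : (delta - c) *: (Q *m f) = (c * rho - rho ^+ 2) *: f.
  apply/eqP; rewrite !scalerBl -[(c * _) *: _]scalerA.
  by rewrite subr_eq addrAC eq_sym subr_eq fE addrC.
have [dc|dc] := eqVneq (delta - c) 0.
  (* Here [rho = delta] is forced, where [err_eig] is constantly one half, so any index serves. *)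
  exists ord0; move: cf; rewrite dc scale0r => /esym/eqP.
  rewrite scaler_eq0 (negPf f0) orbF => /eqP cr.
  have {dc}cE : c = delta by apply/esym/subr0_eq.
  have rd : rho = delta.
    apply: (mulIf (lt0r_neq0 rho_gt0)); rewrite -expr2 -cE.
    by apply/esym/subr0_eq.
  rewrite {1}rd (err_eig_delta delta_gt0 (lambda_gt0 _)).
  apply: (mulfI dr_neq0); rewrite -/c cE rd.
  by field.
have Qf : Q *m f = ((c * rho - rho ^+ 2) / (delta - c)) *: f.
  by rewrite mulrC -scalerA -cf scalerA mulVf // scale1r.
have [i li] := eigenvector_lambda f0 Qf; exists i.
have cE : delta * lambda i + rho ^+ 2 = c * (lambda i + rho).
  by rewrite -li; field.
rewrite /err_eig cE /c; field.
by rewrite dr_neq0 lt0r_neq0 // addr_gt0 ?lambda_gt0.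
Qed.

(** In terms of [f], the form is a nonnegative combination of the squared norms of [Q *m f] and [f]
    and the form of [Q] at [f]. *)
Lemma errmx_psd u : 0 <= dot u (errmx rho *m u).
Proof.
pose f := invmx (Q + rho%:M) *m u.
have -> : u = Q *m f + rho *: f by rewrite -shiftE mulKVmx.
have d0 := ltW delta_gt0; have r0 := ltW rho_gt0.
rewrite errmx_shift dotZr mulr_ge0 ?invr_ge0 ?addr_ge0 //.
rewrite !(dotDl, dotDr, dotZl, dotZr) (dot_mulmxl f f Q_sym).
by rewrite !(addr_ge0, mulr_ge0, exprn_ge0, dot_ge0).
Qed.

Let factor := max_err_eig delta lambda1 lambdan rho.

Lemma factor_bounds : 0 < factor < 1.
Proof.
have lambdan_gt0 := lt_le_trans lambda1_gt0 lambda1_le.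
have /andP[a0 a1] := err_eig_bounds delta_gt0 lambda1_gt0 rho_gt0.
have /andP[_ b1] := err_eig_bounds delta_gt0 lambdan_gt0 rho_gt0.
by rewrite /factor /max_err_eig lt_max a0 gt_max a1 b1.
Qed.

(** The top eigenvalue of [errmx rho] is some [err_eig delta (lambda i) rho], hence at most
    [factor]; as a bound on the form it is at least the values at both ends. *)
Lemma factor_eigenvector : exists2 v : 'cV_n.+1, v != 0 &
  errmx rho *m v = factor *: v /\
  forall u, dot u (errmx rho *m u) <= factor * dot u u.
Proof.
have [m [v [v0 Ev mE]]] := psd_max_eigenvector errmx_sym errmx_psd.
suff mf : m = factor by exists v => //; rewrite -mf.
have err_eig_le_m i : err_eig delta (lambda i) rho <= m.
  have [w w0 /(errmx_eigenvector (lambda_gt0 i)) Ew] := lambda_eigenvector i.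
  by have := mE w; rewrite Ew dotZr ler_pM2r // dot_gt0.
apply/le_anti/andP; split; last by rewrite ge_max !err_eig_le_m.
have [i ->] := errmx_eigenvalue v0 Ev.
exact: err_eig_le_max (lambda_le_ends i) _.
Qed.

(** By [psd_dot_sq], the squared norm of the image is at most [factor] times the form, which is at
    most [factor * dot u u]. *)
Lemma enorm_errmx_le u : enorm (errmx rho *m u) <= factor * enorm u.
Proof.
have [_ _ [_ Ef]] := factor_eigenvector; have /andP[f0 _] := factor_bounds.
have Epsd w : 0 <= dot w (errmx rho *m w) <= factor * dot w w.
  by rewrite errmx_psd Ef.
rewrite -ler_sqr ?nnegrE ?mulr_ge0 ?sqrtr_ge0 ?(ltW f0) // exprMn !enorm_sq.
apply: (le_trans (psd_dot_sq errmx_sym f0 Epsd u)).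
by rewrite expr2 -mulrA ler_pM2l.
Qed.

(** * The iterates: error recursion, guaranteed factor and convergence *)

Lemma admm_mu x z mu : admm_iterates Q q delta rho x z mu ->
  forall k, mu k.+1 = delta *: z k.+1.
Proof.
move=> it k; have [_ zE ->] := it k.
rewrite scalerBr addrA; apply/eqP; rewrite subr_eq -scalerDl zE scalerA.
by rewrite mulfV // scale1r.
Qed.

Lemma admm_z x z mu : admm_iterates Q q delta rho x z mu ->
  forall k, (delta + rho) *: z k.+2 = delta *: z k.+1 + rho *: x k.+2.
Proof.
move=> it k; have [_ -> _] := it k.+1.
by rewrite (admm_mu it) scalerA mulfV // scale1r.
Qed.

Lemma admm_error x z mu : admm_iterates Q q delta rho x z mu ->
  forall k, z k.+2 - minimizer = errmx rho *m (z k.+1 - minimizer).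
Proof.
move=> it k; have [xE _ _] := it k.+1.
set e := z k.+1 - minimizer.
(* By [minimizerP], [(Q + rho%:M) *m minimizer = (rho - delta) *: minimizer - q], so the [q] terms
   cancel. *)
have xe : x k.+2 - minimizer = (rho - delta) *: (invmx (Q + rho%:M) *m e).
  rewrite xE (admm_mu it) -{1}[minimizer](mulKmx unitQ) -mulmxBr scalemxAr.
  congr (_ *m _); rewrite shiftE -[q]opprK -minimizerP opprK.
  rewrite /e scalerBr !scalerBl.
  apply/colP => i; rewrite !mxE; ring.
apply: (scalerI dr_neq0); rewrite scalerBr (admm_z it).
rewrite /errmx -scalemxAl scalerA mulfV // scale1r mulmxDl mul_scalar_mx.
rewrite -scalemxAl -scalerA -xe /e scalerDl !scalerBr.
by apply/colP => i; rewrite !mxE; ring.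
Qed.

(* [z 0] and [mu 0] can be matched so that [x 1 = 0]; then [z 1] is a multiple
   of the free vector [mu 0]. *)
Lemma admm_first_iterate w :
  exists x z mu, admm_iterates Q q delta rho x z mu /\ z 1%N = w.
Proof.
pose upd (s : 'cV[R]_n.+1 * 'cV[R]_n.+1 * 'cV[R]_n.+1) :=
  let x := invmx (Q + rho%:M) *m (rho *: s.1.2 - s.2 - q) in
  let z := (delta + rho)^-1 *: (s.2 + rho *: x) in
  (x, z, s.2 + rho *: (x - z)).
pose mu0 := (delta + rho) *: w.
pose s k := iter k upd (0, rho^-1 *: (mu0 + q), mu0).
exists (fun k => (s k).1.1), (fun k => (s k).1.2), (fun k => (s k).2).
split=> [k|]; first by split.
rewrite /= scalerA mulfV ?lt0r_neq0 // scale1r addrAC addrK subrr.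
by rewrite mulmx0 scaler0 addr0 scalerA mulVf // scale1r.
Qed.

Lemma guaranteed_factorE :
  guaranteed_factor Q q delta minimizer rho = factor%:E.
Proof.
apply/le_anti/andP; split.
  apply: ge_ereal_sup => _ [z [x [mu it]] <-].
  apply: ge_ereal_sup => _ [k /= zk <-].
  rewrite lee_fin ler_pdivrMr ?enorm_gt0 ?subr_eq0 // (admm_error it).
  exact: enorm_errmx_le.
have [v v0 [Ev _]] := factor_eigenvector.
have /andP[/ltW f0 _] := factor_bounds.
(* The error at [z 1] is a top eigenvector, so the first ratio already equals [factor]. *)
have [x [z [mu [it z1]]]] := admm_first_iterate (v + minimizer).
apply: (@le_trans _ _ (convergence_factor (fun k => z k.+1) minimizer)).
  apply: ereal_sup_ubound; exists 0%N => /=.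
    by rewrite z1 -subr_eq0 addrK.
  rewrite (admm_error it) z1 addrK Ev enormZ // mulfK //.
  by rewrite lt0r_neq0 // enorm_gt0.
by apply: ereal_sup_ubound; exists z => //; exists x, mu.
Qed.

Lemma admm_cvg x z mu : admm_iterates Q q delta rho x z mu ->
  x @ \oo --> minimizer /\ z @ \oo --> minimizer.
Proof.
move=> it; have /andP[f0 f1] := factor_bounds.
have zk k : enorm (z k.+1 - minimizer) <=
    factor ^+ k * enorm (z 1%N - minimizer).
  elim: k => [|k IH]; first by rewrite mul1r.
  rewrite (admm_error it) (le_trans (enorm_errmx_le _)) // exprS -mulrA.
  by rewrite ler_pM2l.
have zcvg : z @ \oo --> minimizer.
  rewrite -cvg_shiftS; apply/subr_cvg0; apply: norm_cvg0.
  apply: (@squeeze_cvgr _ _ _ _ (fun=> 0)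
      (fun k => factor ^+ k * enorm (z 1%N - minimizer))).
  - near=> k; rewrite normr_ge0 /=.
    exact: le_trans (mx_norm_le_enorm _) (zk k).
  - exact: cvg_cst.
  - rewrite -[X in _ --> X](mul0r (enorm (z 1%N - minimizer))).
    by apply: cvgMr_tmp; apply: cvg_expr; rewrite ger0_norm // ltW.
split=> //; rewrite -cvg_shiftS -cvg_shiftS.
(* [admm_z] is solved for [x]; it starts at index 2, hence the double shift. *)
have -> : (fun k => x k.+2) =
    (fun k => rho^-1 *: ((delta + rho) *: z k.+2 - delta *: z k.+1)).
  apply/funext => k; rewrite (admm_z it) addrAC subrr add0r scalerA.
  by rewrite mulVf ?lt0r_neq0 // scale1r.
have -> : minimizer =
    rho^-1 *: ((delta + rho) *: minimizer - delta *: minimizer).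
  by rewrite -scalerBl addrAC subrr add0r scalerA mulVf ?lt0r_neq0 // scale1r.
apply: cvgZl_tmp; apply: cvgB; apply: cvgZl_tmp.
  by rewrite (cvg_shiftS (fun k => z k.+1)) cvg_shiftS.
by rewrite cvg_shiftS.
Unshelve. all: by end_near.
Qed.

End FixedStep.
End ADMM.

Theorem theorem1 (R : realType) (n : nat) (Q : 'M[R]_n.+1) (q : 'cV[R]_n.+1)
    (lambda : 'I_n.+1 -> R) (delta : R) :
  posdefmx Q -> sorted_eigenvalues Q lambda -> 0 < delta ->
  exists zs : 'cV[R]_n.+1,
  [/\ forall x z : 'cV[R]_n.+1,
        is_solution Q q delta x z <-> x = zs /\ z = zs,
      forall rho : R, 0 < rho ->
        forall x z mu : nat -> 'cV[R]_n.+1,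
        admm_iterates Q q delta rho x z mu ->
        x @ \oo --> zs /\ z @ \oo --> zs,
      forall rho : R, 0 < rho ->
        exists zeta : R,
          0 < zeta < 1 /\ guaranteed_factor Q q delta zs rho = zeta%:E,
      forall rho : R, optimal_step Q q delta zs rho <->
        rho = rho_star delta (lambda ord0) (lambda ord_max) &
      guaranteed_factor Q q delta zs
          (rho_star delta (lambda ord0) (lambda ord_max)) =
        (zeta_star delta (lambda ord0) (lambda ord_max))%:E].
Proof.
move=> Qpos Qeig d0; exists (minimizer Q q delta).
have a0 := lambda_gt0 Qpos Qeig ord0.
have ab : lambda ord0 <= lambda ord_max by apply: Qeig.2.
have rs0 := rho_star_gt0 d0 a0 ab.
have gE := guaranteed_factorE q Qpos Qeig d0.
have gs : guaranteed_factor Q q delta (minimizer Q q delta)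
    (rho_star delta (lambda ord0) (lambda ord_max)) =
  (zeta_star delta (lambda ord0) (lambda ord_max))%:E.
  by rewrite gE // max_err_eig_rho_star.
split=> //.
- exact: is_solutionP.
- by move=> rho r0 x z mu; apply: (admm_cvg Qpos Qeig d0 r0).
- move=> rho r0; exists (max_err_eig delta (lambda ord0) (lambda ord_max) rho).
  by split; [exact: (factor_bounds Qpos Qeig)|exact: gE].
move=> rho; split=> [[r0 ropt]|->].
  (* Any other step has a factor strictly above that of [rho_star], against optimality. *)
  apply/eqP/negPn/negP => /(max_err_eig_min d0 a0 ab r0).
  by rewrite ltNge -lee_fin -gE // -gs ropt.
split=> // rho' r0; rewrite gs gE // lee_fin.
have [->|/(max_err_eig_min d0 a0 ab r0)/ltW//] :=
  eqVneq rho' (rho_star delta (lambda ord0) (lambda ord_max)).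
by rewrite max_err_eig_rho_star.
Qed.
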